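(* For every honest elementary degree $\mathbf{b}$ with $\mathbf{b} \gg_{\mathrm{E}} \mathbf{0}$, there is an honest elementary degree $\mathbf{a}$ with $\mathbf{a} >_{\mathrm{E}} \mathbf{0}$ such that for every honest elementary degree $\mathbf{c}$, if $\mathbf{a} \cup \mathbf{c} \geq_{\mathrm{E}} \mathbf{b}$ then $\mathbf{c} \geq_{\mathrm{E}} \mathbf{b}$.
   Context: The elementary functions are those generated from the projections, the constants $0$ and $1$, addition and truncated subtraction by composition, bounded sum and bounded product. A function $f$ is elementary in $g$ ($f \leq_{\mathrm{E}} g$) if $f$ can be generated from $g$ and these initial functions by these schemes; $f \equiv_{\mathrm{E}} g$ means $f \leq_{\mathrm{E}} g$ and $g \leq_{\mathrm{E}} f$. A function $f$ is honest if it is unary, satisfies $f(x) \geq 2^x$ for all $x$, is monotone ($f(x) \leq f(x+1)$), and has elementary graph. The honest elementary degree of an honest $f$ is $\{g : g \text{ honest},\ g \equiv_{\mathrm{E}} f\}$; the set $\mathcal{H}$ of these degrees is partially ordered by $\leq_{\mathrm{E}}$, forms a distributive lattice with join $\deg(f) \cup \deg(g) = \deg(\max[f,g])$ (pointwise max), meet via pointwise min, and least element $\mathbf{0} = \deg(2^x)$. For $f,g\colon\omega\to\omega$, $f \ll_{\mathrm{E}} g$ means $(\exists k)(\forall m)(\forall^\infty x)(f^m(x) \leq g^k(x))$, where $f^m$ is the $m$-th iterate; for degrees, $\deg(f) \ll_{\mathrm{E}} \deg(g)$ iff $f \ll_{\mathrm{E}} g$. Thus $\mathbf{b} \gg_{\mathrm{E}}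 \mathbf{0}$ means some member of $\mathbf{b}$ eventually dominates every elementary function. *)

(* Defs.v *)
From mathcomp Require Import all_boot.
From mathcomp Require Import boolp classical_sets.
From mathcomp Require Import zify.

Set Implicit Arguments.
Unset Strict Implicit.
Unset Printing Implicit Defensive.

Local Open Scope classical_set_scope.

Definition nfun (n : nat) := n.-tuple nat -> nat.

Definition unary (f : nat -> nat) : nfun 1 := fun x => f (thead x).

(* [elementary_over G f]: f is generated from the functions of G and the
   initial elementary functions. The bounded variable and the bound are the
   first argument; constants are available in every arity. *)
Inductive elementary_over (G : set (nat -> nat)) :
    forall n : nat, nfun n -> Prop :=
| Elem_oracle g : G g -> elementary_over G (unary g)
| Elem_proj n (i : 'I_n) : elementary_over G (fun x : n.-tuple nat => tnth x i)
| Elem_const0 n : elementary_over G (fun _ : n.-tuple nat => 0)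
| Elem_const1 n : elementary_over G (fun _ : n.-tuple nat => 1)
| Elem_add : elementary_over G
    (fun x : 2.-tuple nat => tnth x ord0 + tnth x ord_max)
| Elem_sub : elementary_over G
    (fun x : 2.-tuple nat => tnth x ord0 - tnth x ord_max)
| Elem_comp m n (h : nfun m) (gs : 'I_m -> nfun n) :
    elementary_over G h -> (forall i, elementary_over G (gs i)) ->
    elementary_over G (fun x => h [tuple gs i x | i < m])
| Elem_bsum n (f : nfun n.+1) : elementary_over G f ->
    elementary_over G
      (fun x : n.+1.-tuple nat => \sum_(i < thead x) f [tuple of nat_of_ord i :: behead x])
| Elem_bprod n (f : nfun n.+1) : elementary_over G f ->
    elementary_over G
      (fun x : n.+1.-tuple nat => \prod_(i < thead x) f [tuple of nat_of_ord i :: behead x]).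

Definition elementary n (f : nfun n) : Prop := elementary_over set0 f.

Definition leE (f g : nat -> nat) : Prop := elementary_over [set g] (unary f).

Definition eqE (f g : nat -> nat) : Prop := leE f g /\ leE g f.

Definition elementary_graph (f : nat -> nat) : Prop :=
  elementary (fun x : 2.-tuple nat => f (tnth x ord0) == tnth x ord_max : nat).

Definition honest (f : nat -> nat) : Prop :=
  [/\ forall x, 2 ^ x <= f x, forall x, f x <= f x.+1 & elementary_graph f].

Definition llE (f g : nat -> nat) : Prop :=
  exists k, forall m, exists N, forall x, N <= x -> iter m f x <= iter k g x.

Definition degree_set (f : nat -> nat) : set (nat -> nat) :=
  [set g | honest g /\ eqE g f].

Record hdegree := HDegree {
  members :> set (nat -> nat);
  membersP : exists2 f, honest f & members = degree_set f }.

Definition deg (f : nat -> nat) (hf : honest f) : hdegree :=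
  HDegree (ex_intro2 _ _ f hf erefl).

(* A relation between degrees is read on representatives; see [deg_leE]. *)
Definition deg_le (a b : hdegree) : Prop :=
  exists f g, [/\ (a : set _) f, (b : set _) g & leE f g].

Definition deg_lt (a b : hdegree) : Prop := deg_le a b /\ ~ deg_le b a.

Definition deg_ll (a b : hdegree) : Prop :=
  exists f g, [/\ (a : set _) f, (b : set _) g & llE f g].

Section Closure.
Variable G : set (nat -> nat).

Lemma elementary_over_comp2 n (h : nfun 2) (f g : nfun n) :
  elementary_over G h -> elementary_over G f -> elementary_over G g ->
  elementary_over G (fun x => h [tuple f x; g x]).
Proof.
move=> hh hf hg.
have := @Elem_comp G 2 n h (fun i => if i == ord0 then f else g) hh.
have -> : (fun x => h [tuple (if i == ord0 then f else g) x | i < 2]) =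
          (fun x => h [tuple f x; g x]).
  apply/funext => x; congr h; apply: eq_from_tnth => i.
  by rewrite tnth_mktuple; case: i => [[|[|]]].
by apply=> i; case: ifP.
Qed.

Lemma elementary_over_add n (f g : nfun n) :
  elementary_over G f -> elementary_over G g ->
  elementary_over G (fun x => f x + g x).
Proof. exact: elementary_over_comp2 (Elem_add G). Qed.

Lemma elementary_over_sub n (f g : nfun n) :
  elementary_over G f -> elementary_over G g ->
  elementary_over G (fun x => f x - g x).
Proof. exact: elementary_over_comp2 (Elem_sub G). Qed.

Let bound_comp n (h : nfun n.+1) (b : nfun n) :
  elementary_over G h -> elementary_over G b ->
  elementary_over G (fun x => h [tuple of b x :: x]).
Proof.
move=> hh hb.
pose gs (i : 'I_n.+1) : nfun n :=
  if unlift ord0 i is Some j then fun x => tnth x j else b.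
have := @Elem_comp G n.+1 n h gs hh.
have -> : (fun x => h [tuple gs i x | i < n.+1]) =
          (fun x => h [tuple of b x :: x]).
  apply/funext => x; congr h; apply: eq_from_tnth => i.
  rewrite tnth_mktuple /gs; case: unliftP => [j ->|->].
    by rewrite tnthS.
  by rewrite tnth0.
by apply=> i; rewrite /gs; case: unliftP => [j _|_ //]; exact: Elem_proj.
Qed.

Lemma elementary_over_bsum n (f : nfun n.+1) (b : nfun n) :
  elementary_over G f -> elementary_over G b ->
  elementary_over G (fun x => \sum_(i < b x) f [tuple of nat_of_ord i :: x]).
Proof.
move=> hf hb; have := bound_comp (Elem_bsum hf) hb.
congr elementary_over; apply/funext => x; apply: eq_bigr => i _.
by congr f; apply: val_inj.
Qed.

Lemma elementary_over_bprod n (f : nfun n.+1) (b : nfun n) :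
  elementary_over G f -> elementary_over G b ->
  elementary_over G (fun x => \prod_(i < b x) f [tuple of nat_of_ord i :: x]).
Proof.
move=> hf hb; have := bound_comp (Elem_bprod hf) hb.
congr elementary_over; apply/funext => x; apply: eq_bigr => i _.
by congr f; apply: val_inj.
Qed.

Let tail_comp n (f : nfun n) :
  elementary_over G f ->
  elementary_over G (fun x : n.+1.-tuple nat => f [tuple of behead x]).
Proof.
move=> hf; have := Elem_comp hf (fun i => Elem_proj G (lift ord0 i)).
congr elementary_over; apply/funext => x; congr f; apply: eq_from_tnth => i.
by rewrite tnth_mktuple [in LHS](tuple_eta x) tnthS.
Qed.

Lemma elementary_over_mul n (f g : nfun n) :
  elementary_over G f -> elementary_over G g ->
  elementary_over G (fun x => f x * g x).
Proof.
move=> hf hg; have := elementary_over_bsum (tail_comp hg) hf.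
congr elementary_over; apply/funext => x.
transitivity (\sum_(i < f x) g x); last by rewrite sum_nat_const card_ord.
by apply: eq_bigr => i _; congr g; apply: val_inj.
Qed.

Lemma elementary_over_eq n (f g : nfun n) :
  elementary_over G f -> elementary_over G g ->
  elementary_over G (fun x => f x == g x : nat).
Proof.
move=> hf hg.
have := elementary_over_sub (Elem_const1 G n)
  (elementary_over_add (elementary_over_sub hf hg) (elementary_over_sub hg hf)).
congr elementary_over; apply/funext => x.
rewrite eqn_leq -!subn_eq0 -addn_eq0.
by case: (_ + _).
Qed.

Lemma elementary_over_max n (f g : nfun n) :
  elementary_over G f -> elementary_over G g ->
  elementary_over G (fun x => maxn (f x) (g x)).
Proof.
move=> hf hg; have := elementary_over_add hf (elementary_over_sub hg hf).
by congr elementary_over; apply/funext => x; rewrite maxnE.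
Qed.

End Closure.

Lemma elementary_over_trans (G H : set (nat -> nat)) n (f : nfun n) :
  (forall g, G g -> elementary_over H (unary g)) ->
  elementary_over G f -> elementary_over H f.
Proof. by move=> GH; elim => *; [exact: GH | constructor ..]. Qed.

Lemma elementary_weaken (G : set (nat -> nat)) n (f : nfun n) :
  elementary f -> elementary_over G f.
Proof. exact: elementary_over_trans. Qed.

Lemma leE_refl f : leE f f.
Proof. exact: Elem_oracle. Qed.

Lemma leE_trans f g h : leE f g -> leE g h -> leE f h.
Proof. by move=> fg gh; apply: elementary_over_trans fg => _ ->. Qed.

Lemma eqE_refl f : eqE f f.
Proof. by split; exact: leE_refl. Qed.

Lemma eqE_sym f g : eqE f g -> eqE g f.
Proof. by case. Qed.

Lemma eqE_trans f g h : eqE f g -> eqE g h -> eqE f h.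
Proof. by case=> fg gf [gh hg]; split; [exact: leE_trans gh|exact: leE_trans gf]. Qed.

Definition maxf (f g : nat -> nat) : nat -> nat := fun x => maxn (f x) (g x).

Lemma maxfC f g : maxf f g = maxf g f.
Proof. by apply/funext => x; rewrite /maxf maxnC. Qed.

Lemma sum_eq_nat (a b : nat) (F : nat -> nat) :
  \sum_(i < b) (a == i : nat) * F i = if a < b then F a else 0.
Proof.
rewrite (eq_bigr (fun i : 'I_b => if a == i :> nat then F i else 0)); last first.
  by move=> i _; case: eqP => _; rewrite (mul1n, mul0n).
rewrite -big_mkcond; case: ltnP => ab.
  by rewrite (big_pred1 (Ordinal ab)) // => i /=; rewrite eq_sym -val_eqE.
by rewrite big_pred0 // => i; apply/negbTE; rewrite neq_ltn (leq_trans _ ab) ?orbT.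
Qed.

Lemma graph_comp (G : set (nat -> nat)) n f (a b : nfun n) :
  elementary_graph f -> elementary_over G a -> elementary_over G b ->
  elementary_over G (fun x => f (a x) == b x : nat).
Proof. by move/(@elementary_weaken G); exact: elementary_over_comp2. Qed.

Lemma graph_le f : elementary_graph f ->
  elementary (fun x : 2.-tuple nat => f (tnth x ord0) <= tnth x ord_max : nat).
Proof.
move=> hf.
have hb : elementary (fun x : 2.-tuple nat => tnth x ord_max + 1).
  by apply: elementary_over_add; [exact: Elem_proj | exact: Elem_const1].
have hc := graph_comp hf (Elem_proj set0 (lift ord0 (ord0 : 'I_2)))
  (Elem_proj set0 (ord0 : 'I_3)).
have := elementary_over_bsum hc hb.
congr elementary_over; apply/funext => x.
under eq_bigr => i _ do rewrite tnthS tnth0 -[nat_of_bool _]muln1.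
by rewrite (sum_eq_nat _ _ (fun=> 1)) addn1 ltnS; case: (_ <= _).
Qed.

Lemma honest_maxf f g : honest f -> honest g -> honest (maxf f g).
Proof.
case=> f2 fm fg [g2 gm gg]; split.
- by move=> x; rewrite (leq_trans (f2 x)) ?leq_maxl.
- by move=> x; rewrite geq_max !leq_max fm gm orbT.
have := elementary_over_sub
  (elementary_over_add (elementary_over_mul fg (graph_le gg))
                       (elementary_over_mul gg (graph_le fg)))
  (elementary_over_mul fg gg).
congr elementary_over; apply/funext => x; rewrite /maxf.
by case: (ltngtP (f _) (g _)) => fgx; case: (ltngtP (f _) (tnth x _));
   case: (ltngtP (g _) (tnth x _)) => //; lia.
Qed.

Lemma leE_maxl f g : elementary_graph f -> leE f (maxf f g).
Proof.
move=> hf.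
have hb : elementary_over [set maxf f g] (fun x => unary (maxf f g) x + 1).
  by apply: elementary_over_add; [exact: Elem_oracle | exact: Elem_const1].
have hc := graph_comp hf (Elem_proj [set maxf f g] (lift ord0 (ord0 : 'I_1)))
  (Elem_proj [set maxf f g] (ord0 : 'I_2)).
have := elementary_over_bsum
  (elementary_over_mul hc (Elem_proj [set maxf f g] (ord0 : 'I_2))) hb.
congr elementary_over; apply/funext => x.
under eq_bigr => i _ do rewrite tnthS tnth0.
by rewrite (sum_eq_nat _ _ id) addn1 ltnS leq_maxl.
Qed.

Lemma leE_maxf f g h : leE f h -> leE g h -> leE (maxf f g) h.
Proof. exact: elementary_over_max. Qed.

Lemma eqE_maxf f f' g g' : honest f -> honest f' -> honest g -> honest g' ->
  eqE f f' -> eqE g g' -> eqE (maxf f g) (maxf f' g').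
Proof.
have le_max f1 f2 g1 g2 : honest f2 -> honest g2 -> leE f1 f2 -> leE g1 g2 ->
    leE (maxf f1 g1) (maxf f2 g2).
  move=> [_ _ hf2] [_ _ hg2] lef leg; apply: leE_maxf.
    exact/(leE_trans lef)/leE_maxl.
  by apply: (leE_trans leg); rewrite maxfC; exact: leE_maxl.
by move=> hf hf' hg hg' [ff' f'f] [gg' g'g]; split; exact: le_max.
Qed.

(* [join_degree_set] shows that this is again a degree, that of [maxf f g]. *)
Definition join_set (a b : set (nat -> nat)) : set (nat -> nat) :=
  [set h | exists f g, [/\ a f, b g & degree_set (maxf f g) h]].

Lemma join_degree_set f g : honest f -> honest g ->
  join_set (degree_set f) (degree_set g) = degree_set (maxf f g).
Proof.
move=> hf hg; apply/seteqP; split=> h.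
  move=> [f' [g' [[hf' ff'] [hg' gg'] [hh e]]]]; split=> //.
  exact/(eqE_trans e)/eqE_maxf.
by move=> hh; exists f, g; split=> //; split=> //; exact: eqE_refl.
Qed.

Lemma join_setP (a b : hdegree) :
  exists2 h, honest h & join_set a b = degree_set h.
Proof.
case: a b => A [f hf eA] [B [g hg eB]] /=; rewrite eA eB; exists (maxf f g).
  exact: honest_maxf.
exact: join_degree_set.
Qed.

Definition deg_join (a b : hdegree) : hdegree := HDegree (join_setP a b).

Lemma deg_joinE f g (hf : honest f) (hg : honest g) :
  deg_join (deg hf) (deg hg) = deg (honest_maxf hf hg) :> set _.
Proof. exact: join_degree_set. Qed.

Lemma deg_leE f g (hf : honest f) (hg : honest g) :
  deg_le (deg hf) (deg hg) <-> leE f g.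
Proof.
split=> [[f' [g' [[_ [_ ff']] [_ [g'g _]] le']]]|fg].
  exact: leE_trans ff' (leE_trans le' g'g).
by exists f, g; split=> //; split=> //; exact: eqE_refl.
Qed.

Lemma honest_exp2 : honest (fun x => 2 ^ x).
Proof.
split=> // [x|]; first by rewrite leq_exp2l.
apply: elementary_over_eq; last exact: Elem_proj.
have h2 : elementary (fun _ : 3.-tuple nat => 2).
  by apply: (@elementary_over_add _ _ (fun=> 1) (fun=> 1)); exact: Elem_const1.
have := elementary_over_bprod h2 (Elem_proj set0 (ord0 : 'I_2)).
congr elementary_over; apply/funext => x.
by rewrite prod_nat_const card_ord.
Qed.

Definition deg0 : hdegree := deg honest_exp2.

(* Main.v *)
(* Let [B], of degree [b], eventually dominate every iterate [tower n] of [2 ^ x].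
   Let [C_0, C_1, ...] be an elementary enumeration, up to iterated exponentials,
   of the honest functions, with [C_i x > tower i.+1 x].  Say that [i] is killed
   at [x] when the [i]-th iterate of [C_i] at [x] is below [B x], and let the
   witness be, at [x], the minimum of [B x] and of the [C_i x] for those [i < x]
   whose killing has not been found by a computation of size [x]; this delay is
   what makes its graph elementary.
   - If [B] is bounded by the [k]-th iterate of [maxf witness c], take [i >= k]
     with [C_i >= c].  If [i] were killed, at a least point [x], then [witness]
     would stay below [C_i] on the interval [x, B x], and the [k]-th iterate of
     the maximum at [x] would be below [B x].  So [i] is never killed, and
     [B] is below the [i]-th iterate of [C_i].
   - If the witness were at most [tower p], then far enough every value of it
     would be some [C_i x] with [i <= p] and [i] never killed.  Among the first
     [p.+1 ^ 2] iterates of the witness some [i] occurs at least [i] times, so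
     the [i]-th iterate of [C_i] is at most [tower (p.+1 ^ 2 * p)], hence below
     [B]: [i] is killed. *)
From mathcomp Require Import all_boot.
From mathcomp Require Import boolp classical_sets.
From mathcomp Require Import zify.
Require Import Defs.

Set Implicit Arguments.
Unset Strict Implicit.
Unset Printing Implicit Defensive.

(** * Elementary functions on environments *)

(* The environment [s] lists the values of the free variables, innermost bound
   variable first; a missing variable reads as [0]. *)
Definition el (G : set (nat -> nat)) (f : seq nat -> nat) :=
  forall n, elementary_over G (fun x : n.-tuple nat => f x).

Section Closure.
Variable G : set (nat -> nat).
Local Notation el := (el G).
Implicit Types (f g b : seq nat -> nat) (p q : seq nat -> bool).

(** Changes of environment under which [el] is stable. The output length may depend only on the
    input length, so that [Elem_comp] applies at each arity. *)
Definition els (u : seq nat -> seq nat) := forall n, exists m,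
  exists2 gs : 'I_m -> nfun n, forall i, elementary_over G (gs i) &
    forall x : n.-tuple nat, u x = [tuple gs i x | i < m].

Lemma el_subst f u : el f -> els u -> el (fun s => f (u s)).
Proof.
move=> hf hu n; have [m [gs hgs ugs]] := hu n.
have := Elem_comp (hf m) hgs; congr elementary_over.
by apply/funext => x; rewrite ugs.
Qed.

Lemma els_nil : els (fun=> [::]).
Proof.
move=> n; exists 0, (fun _ _ => 0) => [[]//|x].
by rewrite /= enum_ord0.
Qed.

Lemma els_behead : els behead.
Proof.
case=> [|n].
  exists 0, (fun _ _ => 0) => [[]//|x].
  by rewrite tuple0 /= enum_ord0.
exists n, (fun i x => tnth x (lift ord0 i)) => [i|x]; first exact: Elem_proj.
rewrite -[behead x]/(val [tuple of behead x]).
congr val; apply: eq_from_tnth => i; rewrite tnth_mktuple.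
by rewrite [in RHS](tuple_eta x) tnthS.
Qed.

Lemma els_cons g u : el g -> els u -> els (fun s => g s :: u s).
Proof.
move=> hg hu n; have [m [gs hgs ugs]] := hu n.
exists m.+1, (fun i => if unlift ord0 i is Some j then gs j else fun x => g x).
  by move=> i; case: unliftP => [j _|_].
move=> x; rewrite ugs.
transitivity (val [tuple of g x :: [tuple gs i x | i < m]]) => //.
congr val; apply: eq_from_tnth => i; rewrite tnth_mktuple.
by case: unliftP => [j ->|->]; rewrite ?tnthS ?tnth_mktuple ?tnth0.
Qed.

Lemma els_comp u v : els u -> els v -> els (fun s => v (u s)).
Proof.
move=> hu hv n; have [m [gs hgs ugs]] := hu n.
have [k [hs hhs uhs]] := hv m.
exists k, (fun i x => hs i [tuple gs j x | j < m]) => [i|x].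
  exact: (Elem_comp (hhs i) hgs).
by rewrite ugs uhs.
Qed.

Lemma el_behead f : el f -> el (fun s => f (behead s)).
Proof. by move=> hf; apply: (el_subst hf els_behead). Qed.

Lemma el_head : el (head 0).
Proof.
case=> [|n].
  have -> : (fun x : 0.-tuple nat => head 0 x) = fun=> 0.
    by apply/funext => x; rewrite tuple0.
  exact: Elem_const0.
have := Elem_proj G (ord0 : 'I_n.+1); congr elementary_over.
by apply/funext => x; rewrite (tnth_nth 0) nth0.
Qed.

Lemma el_ext f g : f =1 g -> el f -> el g.
Proof. by move/funext->. Qed.

Lemma el_add f g : el f -> el g -> el (fun s => f s + g s).
Proof. by move=> hf hg n; exact: elementary_over_add. Qed.

Lemma el_sub f g : el f -> el g -> el (fun s => f s - g s).
Proof. by move=> hf hg n; exact: elementary_over_sub. Qed.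

Lemma el_mul f g : el f -> el g -> el (fun s => f s * g s).
Proof. by move=> hf hg n; exact: elementary_over_mul. Qed.

Lemma el_const c : el (fun=> c).
Proof.
elim: c => [|c IH]; first by move=> n; exact: Elem_const0.
apply: (el_ext (f := fun=> c + 1)) => [s|]; first by rewrite addn1.
by apply: el_add IH _ => n; exact: Elem_const1.
Qed.

Lemma el_S f : el f -> el (fun s => (f s).+1).
Proof.
move=> hf; apply: (el_ext (f := fun s => f s + 1)) => [s|]; first by rewrite addn1.
exact/el_add/el_const.
Qed.

Lemma el_sum (F : nat -> seq nat -> nat) b :
  el (fun s => F (head 0 s) (behead s)) -> el b ->
  el (fun s => \sum_(i < b s) F i s).
Proof. by move=> hF hb n; exact: elementary_over_bsum (hF n.+1) (hb n). Qed.

Lemma el_prod (F : nat -> seq nat -> nat) b :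
  el (fun s => F (head 0 s) (behead s)) -> el b ->
  el (fun s => \prod_(i < b s) F i s).
Proof. by move=> hF hb n; exact: elementary_over_bprod (hF n.+1) (hb n). Qed.

Lemma el_exp f g : el f -> el g -> el (fun s => f s ^ g s).
Proof.
move=> hf hg; apply: (el_ext _ (el_prod (F := fun=> f) (el_behead hf) hg)) => s.
by rewrite prod_nat_const card_ord.
Qed.

Lemma el_eq f g : el f -> el g -> el (fun s => f s == g s).
Proof. by move=> hf hg n; exact: elementary_over_eq. Qed.

Lemma el_leq f g : el f -> el g -> el (fun s => f s <= g s).
Proof.
move=> hf hg; apply: (el_ext _ (el_eq (el_sub hf hg) (el_const 0))) => s.
by rewrite subn_eq0.
Qed.

Lemma el_neg p : el p -> el (fun s => ~~ p s).
Proof.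
move=> hp; apply: (el_ext _ (el_sub (el_const 1) hp)) => s.
by case: (p s).
Qed.

Lemma el_and p q : el p -> el q -> el (fun s => p s && q s).
Proof.
move=> hp hq; apply: (el_ext _ (el_mul hp hq)) => s.
by rewrite mulnb.
Qed.

Lemma el_or p q : el p -> el q -> el (fun s => p s || q s).
Proof.
move=> hp hq; apply: (el_ext _ (el_neg (el_and (el_neg hp) (el_neg hq)))) => s.
by rewrite negb_and !negbK.
Qed.

Lemma el_if p f g : el p -> el f -> el g -> el (fun s => if p s then f s else g s).
Proof.
move=> hp hf hg.
apply: (el_ext _ (el_add (el_mul hp hf) (el_mul (el_neg hp) hg))) => s.
by case: (p s); rewrite ?mul1n ?mul0n ?addn0.
Qed.

(** The product is 1 as long as no success has occurred up to [v], so the sum counts the failures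
    before the first success, and is [b] if there is none. This turns bounded search into the basic
    schemes. *)
Lemma find_iota_sum (p : pred nat) (b : nat) :
  find p (iota 0 b) = \sum_(v < b) \prod_(u < v.+1) ~~ p u.
Proof.
elim: b => [|b IH]; first by rewrite big_ord0.
rewrite big_ord_recr -IH -[in LHS]addn1 iotaD find_cat size_iota.
case: ifP => hp.
  case/hasP: hp => u; rewrite mem_iota => /andP[_ ub] pu.
  by rewrite /= (bigD1 (Ordinal (leqW ub))) //= pu addn0.
have np u : u < b -> p u = false.
  by move=> ub; apply/negbTE/(hasPn (negbT hp)); rewrite mem_iota.
rewrite (_ : find p (iota 0 b) = b); last first.
  by rewrite hasNfind ?hp // size_iota.
rewrite /= big_ord_recr /= big1 ?mul1n => [|i _]; first by case: (p b).
by rewrite np.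
Qed.

Lemma el_find (P : seq nat -> nat -> bool) b :
  el (fun s => P (behead s) (head 0 s)) -> el b ->
  el (fun s => find (P s) (iota 0 (b s))).
Proof.
move=> hP hb.
apply: (el_ext (f := fun s => \sum_(v < b s) \prod_(u < v.+1) ~~ P s u)) => [s|].
  by rewrite find_iota_sum.
apply: (@el_sum (fun v s => \prod_(u < v.+1) ~~ P s u)) hb.
apply: (@el_prod (fun u s => ~~ P (behead s) u)); last exact: el_S el_head.
(* The environment is [u], then [v], then [s]; the test ignores [v]. *)
apply: el_neg; apply: (el_subst hP (u := fun s => head 0 s :: behead (behead s))).
by apply: els_cons el_head _; exact: els_comp els_behead els_behead.
Qed.

Lemma el_has (P : seq nat -> nat -> bool) b :
  el (fun s => P (behead s) (head 0 s)) -> el b ->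
  el (fun s => has (P s) (iota 0 (b s))).
Proof.
move=> hP hb; apply: (el_ext _ (el_leq (el_S (el_find hP hb)) hb)) => s.
by rewrite has_find size_iota.
Qed.

Lemma el_all (P : seq nat -> nat -> bool) b :
  el (fun s => P (behead s) (head 0 s)) -> el b ->
  el (fun s => all (P s) (iota 0 (b s))).
Proof.
move=> hP hb.
apply: (el_ext _ (el_neg (el_has (P := fun s i => ~~ P s i) (el_neg hP) hb))) => s.
by rewrite has_predC negbK.
Qed.

Lemma el_comp1 (h : nat -> nat) f : el (fun s => h (head 0 s)) -> el f ->
  el (fun s => h (f s)).
Proof.
move=> hh hf; apply: (el_subst hh (u := fun s => [:: f s])).
exact: els_cons els_nil.
Qed.

Lemma el_comp2 (h : nat -> nat -> nat) f g :
  el (fun s => h (head 0 s) (head 0 (behead s))) -> el f -> el g ->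
  el (fun s => h (f s) (g s)).
Proof.
move=> hh hf hg; apply: (el_subst hh (u := fun s => [:: f s; g s])).
by apply: els_cons => //; exact: els_cons els_nil.
Qed.

Lemma el_comp3 (h : nat -> nat -> nat -> nat) f g k :
  el (fun s => h (head 0 s) (head 0 (behead s)) (head 0 (behead (behead s)))) ->
  el f -> el g -> el k ->
  el (fun s => h (f s) (g s) (k s)).
Proof.
move=> hh hf hg hk; apply: (el_subst hh (u := fun s => [:: f s; g s; k s])).
by apply: els_cons => //; apply: els_cons => //; exact: els_cons els_nil.
Qed.
End Closure.

Create HintDb el discriminated.
#[local] Hint Constants Opaque : el.
#[local] Hint Resolve el_head el_const el_add el_sub el_mul el_S el_exp el_eq el_leq el_neg
 el_and el_or el_if el_find el_has el_all : el.

Lemma el_v1 G : el G (fun s => head 0 (behead s)).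
Proof. exact: el_behead (@el_head G). Qed.
Lemma el_v2 G : el G (fun s => head 0 (behead (behead s))).
Proof. exact: el_behead (@el_v1 G). Qed.
Lemma el_v3 G : el G (fun s => head 0 (behead (behead (behead s)))).
Proof. exact: el_behead (@el_v2 G). Qed.
Lemma el_v4 G : el G (fun s => head 0 (behead (behead (behead (behead s))))).
Proof. exact: el_behead (@el_v3 G). Qed.
#[local] Hint Resolve el_v1 el_v2 el_v3 el_v4 : el.

(** * Division, digits and bounded iteration *)

Lemma find_iota_eq (p : pred nat) b m :
  m < b -> p m -> (forall i, i < m -> ~~ p i) -> find p (iota 0 b) = m.
Proof.
move=> mb pm np; have hp : has p (iota 0 b) by apply/hasP; exists m; rewrite ?mem_iota.
have := nth_find 0 hp; have := hp; rewrite has_find size_iota => fb.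
rewrite nth_iota //= add0n => pf.
apply/eqP; rewrite eqn_leq; apply/andP; split; rewrite leqNgt; apply/negP => lt.
  by have := before_find 0 lt; rewrite nth_iota ?pm //; lia.
by have := np _ lt; rewrite pf.
Qed.

Lemma el_div G f g : el G f -> el G g -> el G (fun s => f s %/ g s).
Proof.
apply: el_comp2.
(* The quotient of [x] by [y] is the least [q] with [x < q.+1 * y]; no such [q] exists when [y] is
   0, where the quotient is 0 by convention. *)
apply: (el_ext (f := fun s => if head 0 (behead s) == 0 then 0 else
   find (fun q => head 0 s < q.+1 * head 0 (behead s)) (iota 0 (head 0 s).+1))).
  move=> s; move: (head 0 s) (head 0 _) => x y.
  case: eqP => [->|/eqP]; rewrite -?lt0n ?divn0 // => y0.
  apply: find_iota_eq; rewrite ?ltnS ?leq_div ?ltn_ceil // => i ix.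
  by rewrite -leqNgt -leq_divRL.
by auto 100 with el.
Qed.

Lemma el_mod G f g : el G f -> el G g -> el G (fun s => f s %% g s).
Proof.
apply: el_comp2.
apply: (el_ext (f := fun s => head 0 s - head 0 s %/ head 0 (behead s) * head 0 (behead s))).
  by move=> s; rewrite {1}(divn_eq (head 0 s) (head 0 (behead s))) addKn.
by auto 100 using el_div with el.
Qed.
#[local] Hint Resolve el_div el_mod : el.

Definition digit z w i := w %/ z ^ i %% z.

Lemma el_digit G f g h : el G f -> el G g -> el G h ->
  el G (fun s => digit (f s) (g s) (h s)).
Proof. by rewrite /digit; auto 10 with el. Qed.
#[local] Hint Resolve el_digit : el.

Definition digits z n (u : nat -> nat) := \sum_(i < n) u i * z ^ i.

Lemma digits_lt z n u : (forall i, i < n -> u i < z) -> digits z n u < z ^ n.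
Proof.
rewrite /digits; elim: n => [|n IH] uz; first by rewrite big_ord0.
rewrite big_ord_recr /= expnS.
have := IH (fun i lt => uz i (leqW lt)) => lt; rewrite -addSn.
by apply: leq_trans (leq_mul (uz n _) (leqnn _)); rewrite ?mulSn ?leq_add2r.
Qed.

Lemma digit_digits z n u i : (forall i, i < n -> u i < z) ->
  digit z (digits z n u) i = if i < n then u i else 0.
Proof.
rewrite /digits /digit; elim: n i => [|n IH] i uz.
  by rewrite big_ord0 div0n mod0n.
rewrite big_ord_recr /=.
have z0 : 0 < z by apply: leq_ltn_trans (uz n _).
have lt := @digits_lt z n u (fun i lt => uz i (leqW lt)).
case: (ltngtP i n) => [lt_in|lt_ni|->].
(* Below the top position, the last term contributes a multiple of [z] to the quotient by [z ^ i],
   so it vanishes modulo [z]. *)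
- have -> : u n * z ^ n = (u n * z ^ (n - i.+1) * z) * z ^ i.
    by rewrite -!mulnA -expnS -expnD subnK.
  rewrite ltnS (ltnW lt_in) addnC divnMDl ?expn_gt0 ?z0 // modnMDl.
  by rewrite IH ?lt_in // => j jn; apply: uz; exact: leqW.
- rewrite ltnS leqNgt lt_ni /= divn_small ?mod0n //.
  have := digits_lt uz; rewrite /digits big_ord_recr /= => /leq_trans; apply.
  by rewrite leq_pexp2l.
- rewrite leqnn addnC divnMDl ?expn_gt0 ?z0 // (divn_small lt) addn0 modn_small //.
  exact: uz.
Qed.

(* The sequence of the values is guessed as the digits, in base [b.+1], of a
   number. *)
Lemma el_iteri G (h : nat -> nat -> seq nat -> nat) n r b :
  el G (fun s => h (head 0 s) (head 0 (behead s)) (behead (behead s))) ->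
  el G n -> el G r -> el G b ->
  (forall s t, t <= n s -> iteri t (fun t v => h t v s) (r s) <= b s) ->
  el G (fun s => iteri (n s) (fun t v => h t v s) (r s)).
Proof.
move=> hh hn hr hb bd.
apply: (el_ext (f := fun s => find (fun v => has (fun w =>
   [&& digit (b s).+1 w 0 == r s, 
     all (fun t => digit (b s).+1 w t.+1 == h t (digit (b s).+1 w t) s) (iota 0 (n s)) &
     digit (b s).+1 w (n s) == v]) (iota 0 ((b s).+1 ^ (n s).+1))) (iota 0 (b s).+1))).
  move=> s; pose u t := iteri t (fun t v => h t v s) (r s).
  have ub i : i < (n s).+1 -> u i < (b s).+1 by rewrite !ltnS; exact: bd.
  apply: find_iota_eq; first by rewrite ltnS bd.
    apply/hasP; exists (digits (b s).+1 (n s).+1 u).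
      by rewrite mem_iota; exact: digits_lt.
    rewrite !digit_digits // eqxx ltnSn eqxx andbT.
    apply/allP => t; rewrite mem_iota => /andP[_ lt].
    by rewrite !digit_digits // ltnS lt ltnS (ltnW lt).
  move=> v lt; apply/hasP => -[w _ /and3P[/eqP w0 /allP w1 /eqP w2]].
  (* Any accepted [w] has the iterates as its digits, so no smaller value [v] is accepted. *)
  have wu t : t <= n s -> digit (b s).+1 w t = u t.
    elim: t => // t IH lt'; have := w1 t; rewrite mem_iota => /(_ lt') /eqP ->.
    by rewrite IH // ltnW.
  by move: lt; rewrite -w2 wu // ltnn.
have h2 := el_behead (el_behead hn).
have h3 := el_behead (el_behead hb).
have h4 := el_behead h3.
have h5 := el_behead (el_behead hr).
have h6 := el_behead hb.
have h7 := el_behead hn.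
have h8 : el G (fun s => h (head 0 s)
  (digit (b (behead (behead (behead s)))).+1 (head 0 (behead s)) (head 0 s))
  (behead (behead (behead s)))).
  apply: (el_subst hh (u := fun s => [:: head 0 s,
   digit (b (behead (behead (behead s)))).+1 (head 0 (behead s)) (head 0 s) &
   behead (behead (behead s))])).
  apply: els_cons; first by auto with el.
  apply: els_cons; first by auto 10 with el.
  exact: els_comp (els_comp (els_behead G) (els_behead G)) (els_behead G).
by auto 20 with el.
Qed.

(** * A pairing function with elementary projections *)

Definition sqrtn n := find (fun r => n < r.+1 ^ 2) (iota 0 n.+1).

(** The value lies between the squares of [x + y] and of [x + y + 1], so its integer square root
    recovers [x + y]. *)
Definition pairn x y := (x + y) ^ 2 + x.
Definition fstn n := n - sqrtn n ^ 2.
Definition sndn n := sqrtn n - fstn n.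

Lemma sqrtn_pairn x y : sqrtn (pairn x y) = x + y.
Proof.
apply: find_iota_eq => [||r lt]; rewrite /pairn -?leqNgt; first by nia.
  by rewrite -addn1 sqrnD; nia.
by have : r.+1 ^ 2 <= (x + y) ^ 2; [rewrite leq_sqr | lia].
Qed.

Lemma fstn_pairn x y : fstn (pairn x y) = x.
Proof. by rewrite /fstn sqrtn_pairn /pairn addKn. Qed.

Lemma sndn_pairn x y : sndn (pairn x y) = y.
Proof. by rewrite /sndn fstn_pairn sqrtn_pairn addKn. Qed.

Lemma leq_pairn x y x' y' : x <= x' -> y <= y' -> pairn x y <= pairn x' y'.
Proof. by move=> h h'; rewrite /pairn leq_add // leq_sqr leq_add. Qed.

Lemma fstn_le x y : x <= pairn x y.
Proof. exact: leq_addl. Qed.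

Lemma sndn_le x y : y <= pairn x y.
Proof. rewrite /pairn; nia. Qed.

(** Used with [x] the positive tag of a program: subprograms have strictly smaller codes. *)
Lemma sndn_lt x y : 0 < x -> y < pairn x y.
Proof. rewrite /pairn; nia. Qed.

Lemma el_pairn G f g : el G f -> el G g -> el G (fun s => pairn (f s) (g s)).
Proof. by rewrite /pairn; auto 10 with el. Qed.

Lemma el_sqrtn G f : el G f -> el G (fun s => sqrtn (f s)).
Proof. by apply: el_comp1; rewrite /sqrtn; auto 10 with el. Qed.

Lemma el_fstn G f : el G f -> el G (fun s => fstn (f s)).
Proof. by rewrite /fstn; auto 10 using el_sqrtn with el. Qed.

Lemma el_sndn G f : el G f -> el G (fun s => sndn (f s)).
Proof. by rewrite /sndn; auto 10 using el_sqrtn, el_fstn with el. Qed.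
#[local] Hint Resolve el_pairn el_fstn el_sndn : el.

(** * Growth of elementary functions *)

Lemma tnth_le_max n (x : n.-tuple nat) i : tnth x i <= \max_(y <- x) y.
Proof. by apply: leq_bigmax_seq => //; exact: mem_tnth. Qed.

Lemma max_cons n (x : n.+1.-tuple nat) i : i < thead x ->
  \max_(y <- i :: behead x) y <= \max_(y <- x) y.
Proof.
move=> ix; have -> : (x : seq nat) = thead x :: behead x.
  exact: (congr1 val (tuple_eta x)).
by rewrite /= !big_cons geq_max leq_maxr andbT leq_max ltnW.
Qed.

Section Growth.
Variable g : nat -> nat.
Hypothesis g2 : forall x, 2 ^ x <= g x.
Hypothesis gm : {homo g : x y / x <= y}.

Lemma iter_homo k : {homo iter k g : x y / x <= y}.
Proof. by elim: k => // k IH x y xy /=; exact/gm/IH. Qed.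

Lemma iter_ge_id k x : x <= iter k g x.
Proof.
elim: k => // k IH /=; apply: leq_trans IH (leq_trans _ (g2 _)).
exact/ltnW/ltn_expl.
Qed.

Lemma leq_iter k l x : k <= l -> iter k g x <= iter l g x.
Proof. by move=> kl; rewrite -(subnK kl) iterD iter_ge_id. Qed.

Lemma leq_iter2 k l x y : k <= l -> x <= y -> iter k g x <= iter l g y.
Proof. by move=> kl xy; exact: leq_trans (iter_homo _ xy) (leq_iter _ kl). Qed.

Lemma double_le x : x + x <= g x.
Proof.
apply: leq_trans (g2 x); elim: x => // x IH; rewrite expnS.
have := expn_gt0 2 x; lia.
Qed.

Lemma sqr_le x : x * x <= iter 2 g x.
Proof.
apply: leq_trans (g2 _); apply: (@leq_trans (2 ^ (x + x))).
  by rewrite expnD; apply: leq_mul; exact/ltnW/ltn_expl.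
by rewrite leq_exp2l //= double_le.
Qed.

Lemma exp_le x : x ^ x <= iter 3 g x.
Proof.
apply: leq_trans (g2 _); apply: (@leq_trans (2 ^ (x * x))).
  by case: x => // x; rewrite expnM leq_exp2r //; exact/ltnW/ltn_expl.
by rewrite leq_exp2l // sqr_le.
Qed.

Lemma pairn_le x y t : x <= t -> y <= t -> pairn x y <= iter 4 g t.
Proof.
move=> xt yt; rewrite /pairn -mulnn; set u := g t.
have xyu : x + y <= u by apply: leq_trans (double_le t); exact: leq_add.
have xg : x <= iter 2 g u by apply: leq_trans (iter_ge_id _ _); lia.
apply: leq_trans (double_le _); apply: leq_add => //.
apply: leq_trans (sqr_le _); exact: leq_mul.
Qed.

Lemma bigsum_le (F : nat -> nat) t i : i <= t -> (forall k, k < i -> F k <= t) ->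
  \sum_(k < i) F k <= iter 2 g t.
Proof.
move=> it Ft; apply: leq_trans (sqr_le t); apply: (@leq_trans (i * t)).
  rewrite -[i in i * _]card_ord -sum_nat_const; apply: leq_sum => k _.
  exact: Ft.
exact: leq_mul.
Qed.

Lemma bigprod_le (F : nat -> nat) t i : i <= t -> (forall k, k < i -> F k <= t) ->
  \prod_(k < i) F k <= iter 3 g t.
Proof.
move=> it Ft; apply: leq_trans (exp_le t); apply: (@leq_trans (t ^ i)).
  rewrite -[i in _ ^ i]card_ord -prod_nat_const; apply: leq_prod => k _.
  exact: Ft.
case: t it {Ft} => [|t] it; first by move: it; rewrite leqn0 => /eqP->.
by rewrite leq_pexp2l.
Qed.

(** Each scheme costs a fixed number of iterates of [g]: composition adds the outer number to the
    largest inner one, a bounded sum adds 2 and a bounded product 3. *)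
Lemma elementary_over_le n (f : nfun n) : elementary_over [set g] f ->
  exists k, forall x, f x <= iter k g (\max_(y <- x) y).
Proof.
have g0 t : 0 < g t by apply: leq_trans (g2 t); rewrite expn_gt0.
elim=> {n f}.
- by move=> _ ->; exists 1 => x; rewrite /unary /= gm // tnth_le_max.
- by move=> n i; exists 0 => x /=; exact: tnth_le_max.
- by move=> n; exists 0.
- by move=> n; exists 1.
- exists 1 => x; apply: leq_trans (double_le _).
  by apply: leq_add; exact: tnth_le_max.
- exists 0 => x; apply: leq_trans (leq_subr _ _) _; exact: tnth_le_max.
- move=> m n h gs _ [k hk] _ IH.
  have [l hl] := choice IH; exists (k + \max_i l i) => x.
  apply: leq_trans (hk _) _; rewrite iterD; apply: iter_homo.
  apply/bigmax_leqP_seq => y /tnthP[i ->] _; rewrite tnth_mktuple.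
  by apply: leq_trans (hl _ _) _; apply: leq_iter; exact: leq_bigmax.
- move=> n f _ [k hk]; exists (2 + k) => x; rewrite iterD.
  apply: (@bigsum_le (fun i => f [tuple of i :: behead x])).
    by apply: leq_trans (iter_ge_id _ _); exact: tnth_le_max.
  move=> i ix; apply: leq_trans (hk _) _; apply: iter_homo; exact: max_cons.
- move=> n f _ [k hk]; exists (3 + k) => x; rewrite iterD.
  apply: (@bigprod_le (fun i => f [tuple of i :: behead x])).
    by apply: leq_trans (iter_ge_id _ _); exact: tnth_le_max.
  move=> i ix; apply: leq_trans (hk _) _; apply: iter_homo; exact: max_cons.
Qed.

Lemma leE_le f : leE f g -> exists k, forall x, f x <= iter k g x.
Proof.
case/elementary_over_le => k hk; exists k => x.
by have := hk [tuple x]; rewrite big_seq1.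
Qed.
End Growth.

(** * A universal evaluator with values bounded by [z] *)

(** Reducing the argument modulo [z.+1] keeps the position inside the row of [e]. *)
Definition lookup z w e x := digit z.+1 w (e * z.+1 + x %% z.+1).

(* Programs [e = <t, <e1, e2>>] act on arguments coded with [pairn]; [w] is the
   table of the values already computed, at positions [e' * z.+1 + x']. *)
Definition raw_step z w e x :=
  let t := fstn e in
  let e1 := fstn (sndn e) in
  let e2 := sndn (sndn e) in
  let y := pairn (fstn x - 1) (sndn x) in
  if t == 1 then 1 else
  if t == 2 then fstn x else
  if t == 3 then sndn x else
  if t == 4 then pairn (lookup z w e1 x) (lookup z w e2 x) else
  if t == 5 then lookup z w e1 (lookup z w e2 x) else
  if t == 6 then fstn x + fstn (sndn x) else
  if t == 7 then fstn x - fstn (sndn x) else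
  if t == 8 then
    if fstn x == 0 then 0 else lookup z w e y + lookup z w e1 y else
  if t == 9 then
    if fstn x == 0 then 1 else lookup z w e y * lookup z w e1 y else
  0.

(** The last reduction makes every value a digit in base [z.+1], which bounds the table and keeps
    the evaluator elementary; results are meaningful only for [z] large enough. *)
Definition step z w n := raw_step z w (n %/ z.+1) (n %% z.+1) %% z.+1.
Definition table z N := iteri N (fun n w => w + step z w n * z.+1 ^ n) 0.
Definition value z e x := step z (table z (e * z.+1 + x)) (e * z.+1 + x).

Lemma step_lt z w n : step z w n < z.+1.
Proof. by rewrite ltn_mod. Qed.

Lemma tableE z N : table z N = digits z.+1 N (fun n => step z (table z n) n).
Proof.
rewrite /digits; elim: N => [|N IH]; first by rewrite big_ord0.
by rewrite big_ord_recr /= -IH.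
Qed.

Lemma digit_table z N i : i < N -> digit z.+1 (table z N) i = step z (table z i) i.
Proof.
by move=> iN; rewrite tableE digit_digits ?iN // => k _; exact: step_lt.
Qed.

Lemma value_le z e x : value z e x <= z.
Proof. exact: step_lt. Qed.

(** The whole row of a smaller program precedes the row of [e], so any argument may be looked up
    there. *)
Lemma lookup_lt z e e' x x' : e' < e ->
  lookup z (table z (e * z.+1 + x)) e' x' = value z e' (x' %% z.+1).
Proof.
move=> lt; apply: digit_table; have := ltn_pmod x' (ltn0Sn z); nia.
Qed.

(** Needed for bounded sums and products, which call themselves at a smaller argument. *)
Lemma lookup_same z e x x' : x' < x -> x <= z ->
  lookup z (table z (e * z.+1 + x)) e x' = value z e x'.
Proof.
by move=> lt xz; rewrite /lookup modn_small ?digit_table ?ltn_add2l //; lia.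
Qed.

Lemma valueE z e x : x <= z ->
  value z e x = raw_step z (table z (e * z.+1 + x)) e x %% z.+1.
Proof.
move=> xz; rewrite /value /step divnMDl // modnMDl divn_small // addn0.
by rewrite [x %% _]modn_small.
Qed.

Lemma el_lookup G f w g h : el G f -> el G w -> el G g -> el G h ->
  el G (fun s => lookup (f s) (w s) (g s) (h s)).
Proof. by rewrite /lookup; auto 20 with el. Qed.

Lemma el_raw_step G f w g h : el G f -> el G w -> el G g -> el G h ->
  el G (fun s => raw_step (f s) (w s) (g s) (h s)).
Proof. by move=> *; rewrite /raw_step; auto 40 using el_lookup with el. Qed.

Lemma el_step G f w g : el G f -> el G w -> el G g ->
  el G (fun s => step (f s) (w s) (g s)).
Proof. by move=> *; rewrite /step; auto 40 using el_raw_step with el. Qed.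

Lemma el_table G f g : el G f -> el G g -> el G (fun s => table (f s) (g s)).
Proof.
apply: el_comp2.
apply: (@el_iteri _ (fun n w s => w + step (head 0 s) w n * (head 0 s).+1 ^ n) _ _
  (fun s => (head 0 s).+1 ^ head 0 (behead s))); try by auto 40 using el_step with el.
move=> s t ts; rewrite -/(table _ _) tableE.
apply: ltnW; apply: leq_trans (digits_lt _) _ => [i _|]; first exact: step_lt.
by rewrite leq_pexp2l.
Qed.

Lemma el_value G f g h : el G f -> el G g -> el G h ->
  el G (fun s => value (f s) (g s) (h s)).
Proof. by move=> *; rewrite /value; auto 40 using el_step, el_table with el. Qed.
#[local] Hint Resolve el_value : el.

Definition code t e1 e2 := pairn t (pairn e1 e2).

Arguments code : simpl never.
Arguments table : simpl never.

Lemma lookup_fst z t e1 e2 x x' :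
  lookup z (table z (code t.+1 e1 e2 * z.+1 + x)) e1 x' = value z e1 (x' %% z.+1).
Proof. by apply: lookup_lt; apply: leq_ltn_trans (fstn_le e1 e2) (sndn_lt _ _). Qed.

Lemma lookup_snd z t e1 e2 x x' :
  lookup z (table z (code t.+1 e1 e2 * z.+1 + x)) e2 x' = value z e2 (x' %% z.+1).
Proof. by apply: lookup_lt; apply: leq_ltn_trans (sndn_le e1 e2) (sndn_lt _ _). Qed.

Lemma codeK t e1 e2 : (fstn (code t e1 e2) = t) *
  (fstn (sndn (code t e1 e2)) = e1) * (sndn (sndn (code t e1 e2)) = e2).
Proof. by rewrite /code !(fstn_pairn, sndn_pairn). Qed.

Ltac unfold_code := rewrite valueE // /raw_step !codeK ?(fstn_pairn, sndn_pairn) /=.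

Lemma value_zero z x : x <= z -> value z 0 x = 0.
Proof. by move=> xz; rewrite valueE //= mod0n. Qed.

Lemma value_one z x : x <= z -> value z (code 1 0 0) x = 1 %% z.+1.
Proof. by move=> xz; unfold_code. Qed.

Lemma value_fst z x : x <= z -> value z (code 2 0 0) x = fstn x.
Proof. by move=> xz; unfold_code; rewrite modn_small // /fstn; lia. Qed.

Lemma value_snd z x : x <= z -> value z (code 3 0 0) x = sndn x.
Proof. 
move=> xz; unfold_code; rewrite modn_small // /sndn.
suff : sqrtn x <= x by lia.
rewrite leqNgt; apply/negP => /(before_find 0); rewrite nth_iota //.
by nia.
Qed.

Lemma value_pair z e1 e2 x : x <= z ->
  value z (code 4 e1 e2) x = pairn (value z e1 x) (value z e2 x) %% z.+1.
Proof. by move=> xz; unfold_code; rewrite lookup_fst lookup_snd [x %% _]modn_small. Qed.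

Lemma value_comp z e1 e2 x : x <= z ->
  value z (code 5 e1 e2) x = value z e1 (value z e2 x).
Proof.
move=> xz; unfold_code; rewrite lookup_fst lookup_snd [x %% _]modn_small; last by [].
rewrite (@modn_small (value z e2 x)) ?ltnS ?value_le //.
by rewrite modn_small // ltnS value_le.
Qed.

Lemma value_add z x : x <= z ->
  value z (code 6 0 0) x = (fstn x + fstn (sndn x)) %% z.+1.
Proof. by move=> xz; unfold_code. Qed.

Lemma value_sub z x : x <= z ->
  value z (code 7 0 0) x = (fstn x - fstn (sndn x)) %% z.+1.
Proof. by move=> xz; unfold_code. Qed.

Lemma value_sum0 z e q : pairn 0 q <= z -> value z (code 8 e 0) (pairn 0 q) = 0.
Proof. by move=> xz; unfold_code; rewrite mod0n. Qed.

Lemma pairnS_lt i q : pairn i q < pairn i.+1 q.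
Proof. rewrite /pairn; nia. Qed.

Lemma value_sumS z e i q : pairn i.+1 q <= z ->
  value z (code 8 e 0) (pairn i.+1 q) =
    (value z (code 8 e 0) (pairn i q) + value z e (pairn i q)) %% z.+1.
Proof.
move=> xz; unfold_code; have lt := pairnS_lt i q; rewrite subn1 /=.
by rewrite (lookup_same _ lt xz) lookup_fst (@modn_small (pairn i q)) // (ltn_trans lt).
Qed.

Lemma value_prod0 z e q : pairn 0 q <= z ->
  value z (code 9 e 0) (pairn 0 q) = 1 %% z.+1.
Proof. by move=> xz; unfold_code. Qed.

Lemma value_prodS z e i q : pairn i.+1 q <= z ->
  value z (code 9 e 0) (pairn i.+1 q) =
    (value z (code 9 e 0) (pairn i q) * value z e (pairn i q)) %% z.+1.
Proof.
move=> xz; unfold_code; have lt := pairnS_lt i q; rewrite subn1 /=.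
by rewrite (lookup_same _ lt xz) lookup_fst (@modn_small (pairn i q)) // (ltn_trans lt).
Qed.

(** * Towers, and programs for the elementary functions *)

Definition tower n := iter n (expn 2).

Lemma tower_homo n : {homo tower n : x y / x <= y}.
Proof. by apply: iter_homo => x y xy; rewrite leq_exp2l. Qed.

Lemma leq_tower2 k l x y : k <= l -> x <= y -> tower k x <= tower l y.
Proof. by apply: leq_iter2 => // u v uv; rewrite leq_exp2l. Qed.

Lemma tower_ge n x : x <= tower n x.
Proof. exact: iter_ge_id. Qed.

Lemma tower_gt0 n x : 0 < tower n.+1 x.
Proof. by rewrite /tower /= expn_gt0. Qed.

Lemma tower_lt k l x : k < l -> tower k x < tower l x.
Proof.
move=> kl; apply: leq_trans (leq_tower2 kl (leqnn x)); exact: ltn_expl.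
Qed.

Lemma towerD k l x : tower (k + l) x = tower k (tower l x).
Proof. exact: iterD. Qed.

Definition tcode (s : seq nat) := foldr pairn 0 s.

(** Truncation at [z] is harmless once [z] reaches a tower of fixed height over the coded
    argument. *)
Definition rep n e j (f : nfun n) := forall (x : n.-tuple nat) z,
  tower j (tcode x) <= z ->
  value z e (tcode x) = f x.

Definition representable n (f : nfun n) := exists e j, rep e j f.

Section Rep.
Variable n : nat.
Implicit Types f g : nfun n.

(** Take [z] equal to the tower: the evaluator never exceeds [z]. *)
Lemma rep_le e j f x : rep e j f -> f x <= tower j (tcode x).
Proof. by move=> /(_ x _ (leqnn _)) <-; exact: value_le. Qed.

Lemma rep_mono e j k f : j <= k -> rep e j f -> rep e k f.
Proof.
move=> jk h x z xz; apply: h; apply: leq_trans xz; exact: leq_tower2.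
Qed.

Lemma representable_pair f g : representable f -> representable g ->
  representable (fun x => pairn (f x) (g x)).
Proof.
move=> [e1 [j1 h1]] [e2 [j2 h2]].
have {}h1 := rep_mono (leq_maxl j1 j2) h1.
have {}h2 := rep_mono (leq_maxr j1 j2) h2.
(* By [pairn_le], one pairing costs four exponentials. *)
set j := maxn j1 j2 in h1 h2; exists (code 4 e1 e2), (4 + j) => x z xz.
have xz' : tower j (tcode x) <= z by apply: leq_trans xz; apply: leq_tower2; lia.
rewrite value_pair ?(leq_trans _ xz) ?tower_ge // h1 // h2 // modn_small // ltnS.
apply: leq_trans xz; rewrite towerD; apply: pairn_le => //.
- exact: rep_le h1.
- exact: rep_le h2.
Qed.

Lemma representable0 : representable (fun _ : n.-tuple nat => 0).
Proof. by exists 0, 0 => x z xz; exact: value_zero. Qed.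

Lemma representable_tuple m (gs : 'I_m -> nfun n) :
  (forall i, representable (gs i)) ->
  representable (fun x => tcode [tuple gs i x | i < m]).
Proof.
elim: m gs => [|m IH] gs h.
  have -> : (fun x => tcode [tuple gs i x | i < 0]) = fun=> 0.
    by apply/funext => x; rewrite /= enum_ord0.
  exact: representable0.
have := representable_pair (h ord0) (IH _ (fun i => h (lift ord0 i))).
congr representable; apply/funext => x.
by rewrite /= enum_ordSl /= -map_comp.
Qed.

Lemma representable_comp m (h : nfun m) (gs : 'I_m -> nfun n) :
  representable h -> (forall i, representable (gs i)) ->
  representable (fun x => h [tuple gs i x | i < m]).
Proof.
move=> [e1 [j1 h1]] /representable_tuple[e2 [j2 h2]].
exists (code 5 e1 e2), (j1 + j2) => x z xz.
rewrite value_comp ?(leq_trans _ xz) ?tower_ge // h2; last first.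
  by apply: leq_trans xz; apply: leq_tower2; lia.
apply: h1; apply: leq_trans xz; rewrite towerD; apply: tower_homo.
exact: rep_le h2.
Qed.
End Rep.

Fixpoint proj_code i :=
  if i is j.+1 then code 5 (proj_code j) (code 3 0 0) else code 2 0 0.

Lemma tcode_behead s : sndn (tcode s) = tcode (behead s).
Proof. by case: s => // a s; exact: sndn_pairn. Qed.

Lemma fstn_tcode s : fstn (tcode s) = head 0 s.
Proof. by case: s => // a s; exact: fstn_pairn. Qed.

Lemma value_proj z i s : tcode s <= z -> value z (proj_code i) (tcode s) = nth 0 s i.
Proof.
elim: i s => [|i IH] s sz; first by rewrite value_fst // fstn_tcode nth0.
rewrite [proj_code _]/= value_comp // value_snd // tcode_behead IH ?nth_behead //.
by case: s sz => // a s; apply: leq_trans; exact: sndn_le.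
Qed.

Lemma tcode_cons n (x : n.+1.-tuple nat) : tcode x = pairn (thead x) (tcode (behead x)).
Proof. by rewrite {1}(tuple_eta x). Qed.

(** Common to bounded sums and products; 3 is the larger of their costs in [bigsum_le] and
    [bigprod_le]. *)
Lemma rep_section n e j (f : nfun n.+1) (x : n.+1.-tuple nat) z :
  rep e j f -> tower (3 + j) (tcode x) <= z ->
  let q := tcode (behead x) in
  [/\ forall i, i <= thead x -> pairn i q <= z,
      forall i, i < thead x -> value z e (pairn i q) = f [tuple of i :: behead x],
      forall i, i < thead x -> f [tuple of i :: behead x] <= tower j (tcode x) &
      thead x <= tower j (tcode x)].
Proof.
move=> he xz q.
have le i : i <= thead x -> pairn i q <= tcode x.
  by move=> ib; rewrite tcode_cons leq_pairn.
split=> [i ib|i ib|i ib|].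
- by apply: leq_trans (le _ ib) (leq_trans (tower_ge _ _) xz).
- apply: (he [tuple of i :: behead x]); apply: leq_trans xz.
  by apply: leq_tower2; [lia | exact/le/ltnW].
- apply: leq_trans (rep_le _ he) _; apply: tower_homo; exact/le/ltnW.
- by apply: leq_trans (tower_ge _ _); rewrite tcode_cons fstn_le.
Qed.

Lemma tuple2_codes (x : 2.-tuple nat) :
  (fstn (tcode x) = tnth x ord0) * (fstn (sndn (tcode x)) = tnth x ord_max).
Proof. by rewrite tcode_behead !fstn_tcode !(tnth_nth 0) -!nth0 nth_behead. Qed.

(** Induction on the generation; the oracle case is void. For bounded sums and products, an inner
    induction shows that all partial results stay below [z], so that no reduction modulo [z.+1]
    alters them. *)
Lemma elementary_representable n (f : nfun n) : elementary f -> representable f.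
Proof.
have g2 x : 2 ^ x <= 2 ^ x by [].
have le_tcode m (x : m.-tuple nat) i : tnth x i <= tcode x.
  rewrite (tnth_nth 0); elim: (val x) (val i) => [|a s IH] [|k] //=.
    exact: fstn_le.
  exact: leq_trans (IH k) (sndn_le _ _).
elim=> {n f} [//|n i|n|n|||m n h gs _ IHh _ IHg|n f _ [e [j he]]|n f _ [e [j he]]].
- exists (proj_code i), 0 => x z xz; rewrite value_proj //.
  by rewrite (tnth_nth 0).
- exact: representable0.
- exists (code 1 0 0), 1 => x z xz; rewrite value_one ?modn_small // ?ltnS.
    by apply: leq_trans xz; exact: tower_gt0.
  by apply: leq_trans xz; exact: (tower_ge 1 _).
- exists (code 6 0 0), 1 => x z xz; rewrite value_add; last first.
    by apply: leq_trans xz; exact: (tower_ge 1 _).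
  rewrite !tuple2_codes modn_small // ltnS; apply: leq_trans xz.
  by apply: leq_trans (double_le g2 _); apply: leq_add.
- exists (code 7 0 0), 0 => x z xz; rewrite value_sub //.
  rewrite !tuple2_codes modn_small // ltnS; apply: leq_trans xz.
  exact: leq_trans (leq_subr _ _) (le_tcode _ _ _).
- exact: representable_comp.
- exists (code 8 e 0), (3 + j) => x z xz.
  have [pz vz fz bz] := rep_section he xz.
  suff H i : i <= thead x -> value z (code 8 e 0) (pairn i (tcode (behead x))) =
      \sum_(k < i) f [tuple of nat_of_ord k :: behead x] by rewrite tcode_cons H.
  elim: i => [|i IH] ib.
    by rewrite big_ord0 value_sum0 // pz.
  rewrite value_sumS ?pz // IH ?(ltnW ib) // vz // big_ord_recr /= modn_small // ltnS.
  have := @bigsum_le _ g2 (fun i => f [tuple of i :: behead x]) _ i.+1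
    (leq_trans ib bz) (fun k ki => fz k (leq_trans ki ib)).
  rewrite big_ord_recr /= => /leq_trans; apply; apply: leq_trans xz.
  exact: (@leq_tower2 (2 + j) (3 + j)).
- exists (code 9 e 0), (3 + j) => x z xz.
  have [pz vz fz bz] := rep_section he xz.
  suff H i : i <= thead x -> value z (code 9 e 0) (pairn i (tcode (behead x))) =
      \prod_(k < i) f [tuple of nat_of_ord k :: behead x] by rewrite tcode_cons H.
  elim: i => [|i IH] ib.
    rewrite big_ord0 value_prod0 ?pz // modn_small // ltnS.
    by apply: leq_trans xz; exact: tower_gt0.
  rewrite value_prodS ?pz // IH ?(ltnW ib) // vz // big_ord_recr /= modn_small // ltnS.
  have := @bigprod_le _ g2 (fun i => f [tuple of i :: behead x]) _ i.+1
    (leq_trans ib bz) (fun k ki => fz k (leq_trans ki ib)).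
  rewrite big_ord_recr /= => /leq_trans; apply; apply: leq_trans xz.
  exact: (@leq_tower2 (3 + j) (3 + j)).
Qed.

(** * Iteration below a bound, and truncated towers *)

Lemma el_iter G (h : nat -> seq nat -> nat) n r b :
  el G (fun s => h (head 0 s) (behead s)) ->
  el G n -> el G r -> el G b ->
  (forall s t, t <= n s -> iter t (h^~ s) (r s) <= b s) ->
  el G (fun s => iter (n s) (h^~ s) (r s)).
Proof.
move=> hh hn hr hb bd.
have E s t : iteri t (fun _ v => h v s) (r s) = iter t (h^~ s) (r s).
  by elim: t => //= t ->.
apply: (el_ext (fun s => E s (n s))); apply: (el_iteri (h := fun _ v s => h v s)) hn hr hb _.
  apply: (el_subst hh (u := fun s => head 0 (behead s) :: behead (behead s))).
  by apply: els_cons (el_v1 _) _; exact: els_comp (els_behead G) (els_behead G).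
by move=> s t ts; rewrite E bd.
Qed.

Lemma el_min G f g : el G f -> el G g -> el G (fun s => minn (f s) (g s)).
Proof. by rewrite /minn; auto 10 with el. Qed.
#[local] Hint Resolve el_min : el.

Lemma el_max G f g : el G f -> el G g -> el G (fun s => maxn (f s) (g s)).
Proof. by rewrite /maxn; auto 10 with el. Qed.
#[local] Hint Resolve el_max : el.

(** A tower of variable height is not elementary, so each stage is cut off at [z]. *)
Definition tower_below z n y := iter n (fun t => minn z (2 ^ t)) y.

Lemma tower_belowE z n y : y <= z -> tower_below z n y = minn z (tower n y).
Proof.
move=> yz; elim: n => [|n IH]; first by rewrite /= (minn_idPr yz).
rewrite /tower_below /= -/(tower_below z n y) IH -/(tower n y).
case: (boolP (tower n y <= z)) => [le|]; first by rewrite (minn_idPr le).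
rewrite -ltnNge => lt; rewrite (minn_idPl (ltnW lt)) (minn_idPl (ltnW (ltn_expl _ _))) //.
by rewrite (minn_idPl _) //; apply: ltnW (ltn_trans lt (ltn_expl _ _)).
Qed.

Lemma el_tower_below G f g h : el G f -> el G g -> el G h ->
  el G (fun s => tower_below (f s) (g s) (h s)).
Proof.
apply: el_comp3; rewrite /tower_below.
apply: (@el_iter _ (fun t s => minn (head 0 s) (2 ^ t)) _ _
  (fun s => maxn (head 0 s) (head 0 (behead (behead s))))); try by auto 10 with el.
by move=> s [|t] _ /=; rewrite leq_max ?leqnn ?orbT // geq_minl.
Qed.
#[local] Hint Resolve el_tower_below : el.

(** * The enumeration of the honest functions *)

(* [C_i x] is the least [z] with [approx i x z], if any: [fstn i] is a program for
   the graph of an honest function, which takes the value [y] at [x], and the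
   bound [tower i.+1 y < z] leaves room for the computation checking this. *)
Definition approx i x z := has (fun y =>
  [&& x <= y, tower_below z i.+1 y < z &
      value z (fstn i) (pairn x (pairn y 0)) == 1]) (iota 0 z).

Lemma el_approx G f g h : el G f -> el G g -> el G h ->
  el G (fun s => approx (f s) (g s) (h s)).
Proof.
apply: (@el_comp3 _ (fun i x z => approx i x z)).
by rewrite /approx; auto 20 with el.
Qed.
#[local] Hint Resolve el_approx : el.

(** The clause [x <= y] of [approx] serves here: it makes [C_i] grow fast even when [i] codes no
    honest function. *)
Lemma approx_tower i x z : approx i x z -> tower i.+1 x < z.
Proof.
case/hasP => y; rewrite mem_iota => /andP[_ yz] /and3P[xy].
rewrite tower_belowE ?(ltnW yz) // gtn_min ltnn => lt _.
by apply: leq_ltn_trans lt; exact: tower_homo.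
Qed.

Lemma approx_honest c k : honest c ->
  exists2 i, k <= i & forall x z, approx i x z = (tower i.+1 (c x) < z).
Proof.
case=> c2 _ /elementary_representable[e [j he]].
(* The second component is padding: it forces [k <= i] and [j + 8 <= i], where 8 pays for the two
   pairings that code the argument of the graph. The tower test then guarantees that [z] is large
   enough for [e]. *)
exists (pairn e (j + k + 8)) => [|x z].
  by apply: leq_trans (sndn_le _ _); lia.
set i := pairn _ _.
have ij : j + 8 <= i by apply: leq_trans (sndn_le _ _); lia.
have cv y : x <= y -> tower i.+1 y < z ->
    value z (fstn i) (pairn x (pairn y 0)) = (c x == y).
  move=> xy yz; rewrite /i fstn_pairn; apply: (he [tuple x; y]).
  apply: leq_trans (ltnW yz); apply: leq_trans (_ : tower (j + 8) y <= _).
    rewrite towerD; apply: tower_homo.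
    apply: (@pairn_le (expn 2) _ _ _ (tower 4 y)) => //.
      exact: leq_trans xy (tower_ge _ _).
    by apply: (@pairn_le (expn 2)).
  by apply: leq_tower2 => //; lia.
have xc : x <= c x by apply: leq_trans (c2 x); exact/ltnW/ltn_expl.
apply/hasP/idP => [[y]|lt].
  rewrite mem_iota => /andP[_ yz] /and3P[xy].
  rewrite tower_belowE ?(ltnW yz) // gtn_min ltnn => lt.
  by rewrite cv //; case: (c x =P y) => // ->.
have cz : c x < z by apply: leq_ltn_trans lt; exact: tower_ge.
exists (c x); first by rewrite mem_iota.
by rewrite xc tower_belowE ?(ltnW cz) // gtn_min ltnn lt cv // eqxx.
Qed.

Section Next.
Variables i b : nat.

(** A bounded, monotone substitute for [C_i], which for arbitrary [i] may be partial or not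
    monotone: the minimum runs over all arguments [u >= y], and the value [b] means that nothing was
    found. *)
Definition next y :=
  find (fun v => has (fun u => (y <= u) && approx i u v) (iota 0 v)) (iota 0 b).

Lemma next_le y : next y <= b.
Proof. by rewrite -[leqRHS](size_iota 0) find_size. Qed.

Lemma next_approx y : next y < b -> exists2 u, y <= u & approx i u (next y).
Proof.
move=> lt; have /(nth_find 0) : has (fun v => has (fun u => (y <= u) && approx i u v)
  (iota 0 v)) (iota 0 b) by rewrite has_find size_iota.
by rewrite nth_iota // add0n => /hasP[u _ /andP[yu h]]; exists u.
Qed.

Lemma next_min y u v : v < b -> y <= u -> approx i u v -> next y <= v.
Proof.
move=> vb yu h; rewrite leqNgt; apply/negP => /(before_find 0).
rewrite nth_iota // add0n => /hasP; apply; exists u; last by rewrite yu.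
by rewrite mem_iota; apply: leq_ltn_trans (tower_ge i.+1 u) (approx_tower h).
Qed.

Lemma next_gt y : next y < b -> y < next y.
Proof.
move=> /next_approx[u yu /approx_tower]; apply: leq_ltn_trans.
exact: leq_trans (tower_ge _ _).
Qed.

Lemma iter_next_lt k l x : k <= l -> iter l next x < b -> iter k next x < b.
Proof.
move=> kl; rewrite -(subnK kl) iterD; elim: (l - k) => //= d IH lt.
by apply: IH; exact: ltn_trans (next_gt lt) lt.
Qed.

Variable C : nat -> nat.
Hypothesis Cm : {homo C : x y / x <= y}.
Hypothesis iC : forall x z, approx i x z = (C x <= z).

(** For monotone [C], minimizing over larger arguments changes nothing. With [iter_next_le], the
    iterates of [next] and [C] agree below [b]. *)
Lemma iter_next_ge t x : iter t next x < b -> iter t C x <= iter t next x.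
Proof.
elim: t => //= t IH lt; have lt' := ltn_trans (next_gt lt) lt.
have [u yu] := next_approx lt; rewrite iC; apply: leq_trans.
exact/Cm/(leq_trans (IH lt')).
Qed.

Lemma iter_next_le t x : iter t C x < b -> iter t next x <= iter t C x.
Proof.
elim: t => //= t IH lt.
have h : approx i (iter t C x) (C (iter t C x)) by rewrite iC.
have lt' : iter t C x < C (iter t C x).
  by apply: leq_ltn_trans (approx_tower h); exact: tower_ge.
exact: next_min lt (IH (ltn_trans lt' lt)) h.
Qed.
End Next.

Lemma el_next G f g h : el G f -> el G g -> el G h ->
  el G (fun s => next (f s) (g s) (h s)).
Proof. by apply: el_comp3; rewrite /next; auto 20 with el. Qed.
#[local] Hint Resolve el_next : el.

Lemma el_iter_next G n i b r : el G n -> el G i -> el G b -> el G r ->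
  el G (fun s => iter (n s) (next (i s) (b s)) (r s)).
Proof.
move=> hn hi hb hr.
apply: (@el_iter _ (fun v s => next (i s) (b s) v) _ _ (fun s => maxn (b s) (r s))) => //.
- have := el_behead hi; have := el_behead hb; auto with el.
- by auto with el.
- by move=> s [|t] _ /=; rewrite leq_max ?leqnn ?orbT // next_le.
Qed.
#[local] Hint Resolve el_iter_next : el.

(** * Honest functions, their graphs and their iterates *)

Lemma honest_homo f : honest f -> {homo f : x y / x <= y}.
Proof. by case=> _ fm _; apply: homo_leq => // x y z; exact: leq_trans. Qed.

Lemma honest_gt f x : honest f -> x < f x.
Proof. by case=> f2 _ _; exact: leq_trans (ltn_expl _ _) (f2 x). Qed.

Lemma el_graph G h f g : elementary_graph h -> el G f -> el G g ->
  el G (fun s => h (f s) == g s).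
Proof. by move=> hh hf hg n; exact: graph_comp (hf n) (hg n). Qed.

Lemma el_graph_le G h f g : elementary_graph h -> el G f -> el G g ->
  el G (fun s => h (f s) <= g s).
Proof.
move=> /graph_le/(@elementary_weaken G) hh hf hg n.
exact: elementary_over_comp2 hh (hf n) (hg n).
Qed.

Lemma el_elementary_graph h :
  el set0 (fun s => h (head 0 s) == head 0 (behead s)) -> elementary_graph h.
Proof.
move=> hh; have := hh 2; congr elementary_over; apply/funext => x.
by rewrite !(tnth_nth 0) -!nth0 nth_behead.
Qed.

Lemma el_oracle g f : el [set g] f -> el [set g] (fun s => g (f s)).
Proof.
move=> hf n.
have := Elem_comp (@Elem_oracle [set g] g erefl) (gs := fun _ x => f x) (fun _ => hf n).
by congr elementary_over; apply/funext => x; rewrite /unary /thead tnth_mktuple.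
Qed.

Lemma el_leE f g : el [set g] (fun s => f (head 0 s)) -> leE f g.
Proof.
move=> /(_ 1); congr elementary_over; apply/funext => x.
by rewrite /unary /thead (tnth_nth 0) nth0.
Qed.

(** The value of [f] is found by searching its graph below [h], so reducibility becomes a matter of
    growth. *)
Lemma leE_bounded f g h : elementary_graph f ->
  el [set g] (fun s => h (head 0 s)) -> (forall x, f x <= h x) -> leE f g.
Proof.
move=> hf hh fh; apply: el_leE.
apply: (el_ext (f := fun s => find (fun v => f (head 0 s) == v)
  (iota 0 (h (head 0 s)).+1))) => [s|].
  apply: find_iota_eq; rewrite ?ltnS ?eqxx // => v lt.
  by rewrite neq_ltn lt orbT.
have := @el_graph [set g] f (fun s => head 0 (behead s)) (head 0) hf.
by auto 10 with el.
Qed.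

Lemma honest_iter k g : honest g -> honest (iter k.+1 g).
Proof.
move=> hg; have [g2 _ gg] := hg.
split=> [x|x|].
- by apply: leq_trans (g2 x) _; exact: (leq_iter g2 x (isT : 1 <= k.+1)).
- by apply: iter_homo; first exact: honest_homo.
elim: k => // k IH; apply: el_elementary_graph.
(* The intermediate value [u] is below the final one, because [u < g u]. *)
apply: (el_ext (f := fun s => has (fun u => (iter k.+1 g (head 0 s) == u) &&
    (g u == head 0 (behead s))) (iota 0 (head 0 (behead s)).+1))) => [s|].
  congr nat_of_bool; apply/hasP/eqP => [[u _ /andP[/eqP<- /eqP]]|<-] //.
  exists (iter k.+1 g (head 0 s)); last by rewrite !eqxx.
  by rewrite mem_iota /= add0n ltnS ltnW // honest_gt.
have := @el_graph set0 _ (fun s => head 0 (behead s)) (head 0) IH.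
have := @el_graph set0 _ (head 0) (fun s => head 0 (behead (behead s))) gg.
by auto 20 with el.
Qed.

(** * The witness *)

Section NonCupping.
Variable B : nat -> nat.
Hypothesis hB : honest B.
Hypothesis B_tower : forall p, exists N, forall x, N <= x -> tower p x < B x.

(** The test that the [i]-th iterate of [C_i] at [x] is below [B x], in a form that makes sense for
    every [i]. *)
Definition chain i x := iter i (next i (B x)) x < B x.

(* The condition [B i <= x] makes sure that, up to [i], where [C_i] does not yet
   bound the witness, the latter is at most [x]. *)
Definition killed i X := has (fun x => has (fun b =>
  [&& B x == b, B i <= x & iter i (next i b) x < b]) (iota 0 X)) (iota 0 X).

Lemma killedP i X :
  reflect (exists x, [/\ B x < X, B i <= x & chain i x]) (killed i X).
Proof.
apply: (iffP hasP) => [[x _ /hasP[b]]|[x [xX ix h]]].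
  rewrite mem_iota => /andP[_ bX] /and3P[/eqP E ix h].
  by exists x; rewrite /chain E.
exists x; first by rewrite mem_iota; exact: ltn_trans (honest_gt x hB) xX.
by apply/hasP; exists (B x); rewrite ?mem_iota // eqxx ix.
Qed.

Lemma killed_homo i X Y : X <= Y -> killed i X -> killed i Y.
Proof.
move=> XY /killedP[x [xX ix h]]; apply/killedP; exists x; split=> //.
exact: leq_trans XY.
Qed.

Definition below x z :=
  (B x <= z) || has (fun i => ~~ killed i x && approx i x z) (iota 0 x).
Definition least x := find (below x) (iota 0 (B x)).
(** The running maximum supplies the monotonicity required of honest functions. *)
Definition witness x := \max_(y < x.+1) least y.

Lemma least_leB x : least x <= B x.
Proof. by rewrite -[leqRHS](size_iota 0) find_size. Qed.

Lemma below_least x : below x (least x).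
Proof.
have [lt|] := boolP (least x < B x); last by rewrite -leqNgt /below => ->.
have /(nth_find 0) : has (below x) (iota 0 (B x)) by rewrite has_find size_iota.
by rewrite nth_iota.
Qed.

Lemma least_le x z : below x z -> least x <= z.
Proof.
move=> h; have [le|lt] := leqP (B x) z; first exact: leq_trans (least_leB x) le.
rewrite leqNgt; apply/negP => /(before_find 0).
by rewrite nth_iota // add0n h.
Qed.

Lemma below_exp x z : below x z -> 2 ^ x <= z.
Proof.
case/orP => [|/hasP[i _ /andP[_ /approx_tower lt]]].
  by apply: leq_trans; case: hB.
apply: leq_trans (ltnW lt); exact: (@leq_tower2 1 i.+1).
Qed.

Lemma least_exp x : 2 ^ x <= least x.
Proof. exact/below_exp/below_least. Qed.

Lemma least_witness x : least x <= witness x.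
Proof. exact: (leq_bigmax (@Ordinal x.+1 x (leqnn _))). Qed.

(** The quantifiers are bounded by [x] and [z] alone, whereas the search defining [least] runs up to
    [B x], which is not elementary. *)
Lemma witness_le x z : witness x <= z =
  all (fun y => has (fun v => below y v) (iota 0 z.+1)) (iota 0 x.+1).
Proof.
apply/bigmax_leqP/allP => [h y|h [y yx] _].
  rewrite mem_iota => /andP[_ yx]; apply/hasP; exists (least y).
    by rewrite mem_iota ltnS; exact: (h (Ordinal yx)).
  exact: below_least.
have /h/hasP[v] : y \in iota 0 x.+1 by rewrite mem_iota.
rewrite mem_iota ltnS => /andP[_ vz] /least_le /= h'; exact: leq_trans vz.
Qed.

Lemma honest_witness : honest witness.
Proof.
have [B2 Bm Bg] := hB; split=> [x|x|].
- exact: leq_trans (least_exp x) (least_witness x).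
- by rewrite [leqRHS]/witness big_ord_recr leq_maxl.
have hk : el set0 (fun s => killed (head 0 s) (head 0 (behead s))).
  rewrite /killed.
  have := @el_graph set0 _ (fun s => head 0 (behead s)) (head 0) Bg.
  have := @el_graph_le set0 _ (fun s => head 0 (behead (behead s)))
    (fun s => head 0 (behead s)) Bg.
  by auto 40 with el.
have hb : el set0 (fun s => below (head 0 s) (head 0 (behead s))).
  rewrite /below.
  have := @el_comp2 set0 (fun i x => killed i x) _ _ hk.
  have := @el_graph_le set0 _ (head 0) (fun s => head 0 (behead s)) Bg.
  by auto 40 with el.
have hw : el set0 (fun s => witness (head 0 s) <= head 0 (behead s)).
  apply: (el_ext (fun s => congr1 nat_of_bool (esym (witness_le _ _)))).
  have := @el_comp2 set0 (fun x z => below x z) _ _ hb.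
  by auto 40 with el.
apply: el_elementary_graph.
(* The value is [z] when it is at most [z] but not at most [z - 1]; positivity is tested because
   [0 - 1] is 0. *)
apply: (el_ext (f := fun s => (witness (head 0 s) <= head 0 (behead s)) &&
  ~~ ((0 < head 0 (behead s)) && (witness (head 0 s) <= head 0 (behead s) - 1)))).
  move=> s; congr nat_of_bool.
  move: (witness (head 0 s)) (head 0 (behead s)) => u v; lia.
have := @el_comp2 set0 (fun x y => witness x <= y) _ _ hw.
by auto 40 with el.
Qed.

(** Killing is monotone in the stage, so each index settles, and finitely many settle by a common
    stage. This is not effective. *)
Lemma killed_eventually p : exists N, forall i X, i <= p -> N <= X ->
  killed i X \/ forall Y, ~~ killed i Y.
Proof.
have /choice[n hn] : forall i, exists N, forall X, N <= X ->
    killed i X \/ forall Y, ~~ killed i Y.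
  move=> i; have [[N kN]|nk] := pselect (exists N, killed i N).
    by exists N => X NX; left; exact: killed_homo kN.
  by exists 0 => X _; right=> Y; apply/negP => kY; apply: nk; exists Y.
exists (\max_(i < p.+1) n i) => i X ip NX; apply: hn.
by apply: leq_trans NX; exact: (leq_bigmax (Ordinal (ip : i < p.+1))).
Qed.

Lemma witness_not_elementary : ~ leE witness (expn 2).
Proof.
case/(leE_le (g := expn 2)) => [//|u v uv|p wp]; first by rewrite leq_exp2l.
have lp y : least y <= tower p y := leq_trans (least_witness y) (wp y).
pose M := p.+1 * p.+1.
have [N1 hN1] := killed_eventually p.
have [N2 hN2] := B_tower p; have [N3 hN3] := B_tower (M * p).
pose x := maxn (maxn N1 N2) (maxn N3 (B p)).
have [xN1 xN2 xN3 xB] : [/\ N1 <= x, N2 <= x, N3 <= x & B p <= x].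
  by rewrite /x; split; rewrite !leq_max leqnn ?orbT.
(* The label of [y] is an index supplying [least y]: [B y] is too large, an index above [p] would
   give more than [tower p y], and past [N1] an index not yet killed is never killed. *)
have /choice[lab labP] : forall y, exists i, x <= y ->
    [/\ i <= p, forall Y, ~~ killed i Y & approx i y (least y)].
  move=> y; have [xy|] := boolP (x <= y); last by exists 0.
  have := below_least y; rewrite /below leqNgt (leq_ltn_trans (lp y)) /=; last first.
    by apply: hN2; exact: leq_trans xy.
  case/hasP => i _ /andP[nk h]; exists i => _.
  have ip : i <= p.
    rewrite leqNgt; apply/negP => pi.
    have := leq_ltn_trans (lp y) (leq_ltn_trans (leq_tower2 (ltnW pi) (leqnn y))
      (leq_ltn_trans (tower_ge 0 _) (tower_lt _ (ltnSn i)))).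
    by rewrite ltnNge (ltnW (approx_tower h)).
  split=> //; have [k|//] := hN1 i y ip (leq_trans xN1 xy).
  by rewrite k in nk.
pose u t := iter t least x.
have least_ge y : y <= least y.
  by apply: leq_trans (least_exp y); exact/ltnW/ltn_expl.
have xu t : x <= u t by elim: t => // t IH; exact: leq_trans IH (least_ge _).
have ut t : u t <= tower (t * p) x.
  elim: t => // t IH; apply: leq_trans (lp _) _.
  by rewrite mulSn towerD; exact: tower_homo.
have uB t : t <= M -> u t < B x.
  move=> tM; apply: leq_ltn_trans (ut t) (leq_ltn_trans _ (hN3 x xN3)).
  by apply: leq_tower2; rewrite ?leq_mul2r ?tM ?orbT.
(* A step of the orbit with label [i] goes at least as far as one application of [next i], and the
   other steps do not decrease the orbit; hence [cntP]. *)
pose cnt i t := \sum_(s < t) (lab (u s) == i).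
have cntP i t : t <= M -> iter (cnt i t) (next i (B x)) x <= u t.
  elim: t => [|t IH] tM; first by rewrite /cnt big_ord0.
  rewrite /cnt big_ord_recr -/(cnt i t) /=; case: eqP => [E|_]; last first.
    by rewrite addn0; apply: leq_trans (IH (ltnW tM)) (least_ge _).
  rewrite addn1; have [_ _] := labP _ (xu t); rewrite E.
  by apply: next_min; [exact: (uB t.+1) | exact: IH (ltnW tM)].
(* Pigeonhole: if each of the [p.+1] labels occurred at most [p] times, there would be fewer than
   [M] steps. *)
have [i pi] : exists i : 'I_p.+1, p < cnt i M.
  apply: contrapT => no.
  have : \sum_(i < p.+1) cnt i M <= \sum_(i < p.+1) p.
    by apply: leq_sum => i _; rewrite leqNgt; apply/negP => lt; apply: no; exists i.
  rewrite exchange_big sum_nat_const card_ord /=.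
  under eq_bigr => s _.
    have [lt _ _] := labP _ (xu s).
    rewrite (bigD1 (Ordinal (lt : _ < p.+1))) //= eqxx big1 ?addn0; last first.
      by move=> k; rewrite -val_eqE /= eq_sym => /negbTE->.
    over.
  by rewrite sum_nat_const card_ord /M muln1 leq_mul2l ltnn.
(* As a label, [i] is never killed; but its many occurrences kill it at [x]. *)
have [s /eqP E] : exists s, lab (u s) == i.
  apply: contrapT => no; move: pi; rewrite /cnt big1 // => s _.
  by case: eqP => // /eqP E; case: no; exists s.
have [_ /(_ (B x).+1)/negP[]] := labP _ (xu s); rewrite E.
apply/killedP; exists x; split=> //.
  by apply: leq_trans xB; apply: honest_homo => //; exact: (ltn_ord i).
apply: (@iter_next_lt _ _ i (cnt i M)); first exact: leq_trans (leq_ord i) (ltnW pi).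
by apply: leq_ltn_trans (cntP i M _) (uB M _).
Qed.

Lemma witness_cupping c k : honest c ->
  (forall x, B x <= iter k (maxf witness c) x) -> leE B c.
Proof.
move=> hc Bk; have [i ki hi] := approx_honest k hc.
pose C x := (tower i.+1 (c x)).+1.
have iC x z : approx i x z = (C x <= z) by rewrite hi.
have Cm : {homo C : x y / x <= y}.
  by move=> x y xy; rewrite /C ltnS; apply/tower_homo/honest_homo.
have C_id x : x <= C x.
  by apply: leqW (leq_trans (ltnW (honest_gt x hc)) (tower_ge _ _)).
have [|nk] := pselect (exists x, (B i <= x) && chain i x); last first.
  (* If [i] is never killed, [iter i C] bounds [B] from [B i] on, and the constant covers the
     smaller arguments. Since [i] is fixed, [h] is elementary in [c]. *)
  pose h x := iter i C x + B (B i).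
  apply: (@leE_bounded _ _ h); first by case: hB.
    apply: el_add; last exact: el_const.
    elim: {1}i => [|t IH]; first exact: el_head.
    apply: (@el_S _ (fun s => tower i.+1 (c (iter t C (head 0 s))))).
    rewrite /tower; elim: i.+1 => [|l IHl]; first exact: el_oracle IH.
    by rewrite /=; auto with el.
  move=> x; rewrite /h; have [ix|/ltnW xi] := leqP (B i) x; last first.
    by apply: leq_trans (leq_addl _ _); exact: honest_homo.
  apply: leq_trans (leq_addr _ _); rewrite leqNgt; apply/negP => lt; apply: nk.
  exists x; rewrite ix /chain; exact: leq_ltn_trans (iter_next_le iC lt) lt.
move=> ex; case: (ex_minnP ex) => x /andP[ix chx] xmin.
have iCB t : t <= i -> iter t C x < B x.
  move=> ti; apply: leq_ltn_trans (_ : iter i C x < _).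
    rewrite -(subnK ti) iterD; elim: (i - t) => //= d IH; exact: leq_trans IH _.
  exact: leq_ltn_trans (iter_next_ge Cm iC chx) chx.
(* For [y' <= i] the index [i] is not yet considered, and [least y'] is at most [B i], hence at most
   [x]. *)
have wC y : x <= y -> y < B x -> witness y <= C y.
  move=> xy yB; apply/bigmax_leqP => -[y' /= lt] _; have y'y : y' <= y := lt.
  have [y'i|iy'] := leqP y' i.
    apply: leq_trans (least_leB _) _; apply: leq_trans (honest_homo hB y'i) _.
    exact: leq_trans ix (leq_trans xy (C_id y)).
  apply: (@leq_trans (C y')); last exact: Cm.
  apply: least_le; rewrite /below.
  apply/orP; right; apply/hasP; exists i; first by rewrite mem_iota.
  (* A killing seen at stage [y'] comes from some [x'] with [B x' < y']; minimality of [x] gives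
     [B x <= B x'], against [y' < B x]. *)
  rewrite iC leqnn andbT; apply/killedP => -[x' [x'y' ix' chx']].
  have := xmin x'; rewrite ix' chx' => /(_ isT) /(honest_homo hB) xx'.
  by have := leq_ltn_trans xx' (leq_trans x'y' (leq_trans y'y (ltnW yB))); rewrite ltnn.
have hm := honest_maxf honest_witness hc.
(* Up to time [i] the orbit stays between [x] and [B x], where [wC] applies. At time [i >= k] this
   contradicts the assumed bound on [B]. *)
have mC t : t <= i -> iter t (maxf witness c) x <= iter t C x.
  elim: t => //= t IH ti; have le := IH (ltnW ti).
  apply: leq_trans (Cm _ _ le); rewrite geq_max wC /=.
  - by apply: leqW; exact: tower_ge.
  - by apply: iter_ge_id; case: hm.
  - exact: leq_ltn_trans le (iCB _ (ltnW ti)).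
have := leq_ltn_trans (mC i (leqnn i)) (iCB i (leqnn i)).
have m2 : forall x, 2 ^ x <= maxf witness c x by case: hm.
by rewrite ltnNge (leq_trans (Bk x)) // (leq_iter m2).
Qed.

End NonCupping.

(** * From functions to degrees *)

Theorem theorem3p3 (b : hdegree) :
  deg_ll deg0 b ->
  exists a : hdegree,
    deg_lt deg0 a /\
    forall c : hdegree, deg_le b (deg_join a c) -> deg_le b c.
Proof.
case=> f [g [[hf _] bg [k fg]]].
have [g0 hg0 Eb] := membersP b; have [hg gg0] : degree_set g0 g by rewrite -Eb.
(* The [k]-th iterate of [g] already dominates all towers; one more iteration keeps the function
   honest when [k] is 0. *)
have hB := honest_iter k hg; have g2 : forall x, 2 ^ x <= g x by case: hg.
have f2 : forall x, 2 ^ x <= f x by case: hf.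
have B_tower p : exists N, forall x, N <= x -> tower p x < iter k.+1 g x.
  have [N hN] := fg p.+1; exists N => x /hN le.
  apply: leq_trans (leq_iter g2 x (leqnSn k)); apply: leq_trans le.
  apply: leq_trans (tower_lt x (ltnSn p)) _.
  elim: p.+1 => //= q IH; apply: leq_trans (f2 _); by rewrite leq_exp2l.
have hw := honest_witness hB.
exists (deg hw); split.
  split; first last.
    rewrite deg_leE; exact: witness_not_elementary.
  apply/deg_leE/el_leE; by auto with el.
move=> c [f' [g' [bf' jg' le']]].
have [c0 hc Ec] := membersP c.
have [hg' [g'm _]] : degree_set (maxf (witness (iter k.+1 g)) c0) g'.
  by rewrite -join_degree_set // -Ec.
have [_ [f'g0 g0f']] : degree_set g0 f' by rewrite -Eb.
have gm : leE g (maxf (witness (iter k.+1 g)) c0).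
  apply: leE_trans gg0.1 (leE_trans g0f' (leE_trans le' g'm)).
have hm := honest_maxf hw hc.
have [l hl] : exists l, forall x, g x <= iter l (maxf (witness (iter k.+1 g)) c0) x.
  by apply: leE_le gm; [case: hm | exact: honest_homo].
(* Each application of [g] is bounded by [l] iterates of the maximum. *)
have Bc : leE (iter k.+1 g) c0.
  apply: (witness_cupping hB (k := k.+1 * l)) hc _ => x.
  have mm := honest_homo hm; move: (maxf _ c0) hl mm => m hl mm.
  elim: k.+1 => //= q IH; rewrite mulSn iterD; apply: leq_trans (hl _) _.
  exact: iter_homo.
exists g, c0; split=> //; first by rewrite Ec; split=> //; exact: eqE_refl.
(* Being honest and below its iterate, [g] is elementary in that iterate. *)
have Bn := el_oracle (@el_head [set iter k.+1 g]).
apply: leE_trans Bc; apply: (leE_bounded _ Bn) => [|x]; first by case: hg.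
exact: (leq_iter g2 x (isT : 1 <= k.+1)).
Qed.
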